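(* Let $n,m,k \in \mathbb{N}$ and let $g_1,\dots,g_m \in \mathbb{R}[\overline{X}]$, $\overline{X}=(X_1,\dots,X_n)$, be polynomials such that the quadratic module $M_{g,\mathbb{R}[\overline{X}]}$ generated by $g=(g_1,\dots,g_m)$ in $\mathbb{R}[\overline{X}]$ is Archimedean. Then for every $L \in \mathbb{N}$ there exists $N \in \mathbb{N}$ such that every symmetric matrix polynomial $A \in \mathbb{R}[\overline{X}]^{k\times k}$ of degree at most $L$ satisfying $\|A\| \le L$ and $A(x) \succeq \frac{1}{L} I_k$ for all $x \in S_g$ belongs to the truncated quadratic module $M_{g,\mathbb{R}[\overline{X}]^{k\times k}}[N]$.
   Context: $\mathbb{N}=\{1,2,\dots\}$ and $\mathbb{N}_0=\mathbb{N}\cup\{0\}$. $\deg$ is the total degree of a polynomial; the degree of a matrix with polynomial entries is the maximum of the degrees of its entries; the zero polynomial (matrix) satisfies every upper degree bound. For each $L$, a norm $\|\cdot\|$ is fixed on the finite-dimensional real vector space of $k\times k$ matrices with polynomial entries of degree at most $L$ (all norms on it are equivalent). $S_g=\{x\in\mathbb{R}^n \mid g_i(x)\ge 0 \text{ for all } i=1,\dots,m\}$. For real symmetric matrices, $B \succeq C$ means that $B-C$ is positive semidefinite; $I_k$ is the $k\times k$ identity matrix. For $R=\mathbb{R}[\overline{X}]^{k\times k}$ (including $k=1$, $R=\mathbb{R}[\overline{X}]$) let $\mathrm{SOS}(R)=\{C^TC \mid h\in\mathbb{N}_0,\ C\in\mathbb{R}[\overline{X}]^{h\times k}\}$. The quadratic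 module generated by $g$ in $R$ is $$M_{g,R}=\{S_0+g_1S_1+\dots+g_mS_m \mid S_0,\dots,S_m\in\mathrm{SOS}(R)\},$$ and for $N\in\mathbb{N}$ the truncated quadratic module is $$M_{g,R}[N]=\{S_0+g_1S_1+\dots+g_mS_m \mid S_0,\dots,S_m\in\mathrm{SOS}(R),\ \deg(S_0)\le N,\ \deg(S_ig_i)\le N \text{ for } i=1,\dots,m\}.$$ $M_{g,\mathbb{R}[\overline{X}]}$ is called Archimedean if for every $a\in\mathbb{R}[\overline{X}]$ there exists $N\in\mathbb{N}$ with $a+N\in M_{g,\mathbb{R}[\overline{X}]}$. *)

(* Defs.v *)
From HB Require Import structures.
From mathcomp Require Import all_boot all_order all_algebra.
(* mpoly cannot be imported after the topology files of mathcomp-analysis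
   (incompatible notation levels); the converse order works. *)
From mathcomp Require Import mpoly.
From mathcomp Require Import reals.

Set Implicit Arguments.
Unset Strict Implicit.
Unset Printing Implicit Defensive.

Import GRing.Theory Num.Theory.
Local Open Scope ring_scope.

Section MatrixPolynomials.
Variables (R : realType) (n : nat).

(* msize p = deg p + 1 for p != 0, and msize 0 = 0, so the zero polynomial
   satisfies every degree bound. *)
Definition deg_le (d : nat) (p : {mpoly R[n]}) : Prop := (msize p <= d.+1)%N.

Definition mxdeg_le (d h k : nat) (A : 'M[{mpoly R[n]}]_(h, k)) : Prop :=
  forall i j, deg_le d (A i j).

Definition mxeval (h k : nat) (A : 'M[{mpoly R[n]}]_(h, k)) (x : 'rV[R]_n) :
  'M[R]_(h, k) := map_mx (fun p => p.@[x 0]) A.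

(* c%:MP *: A is the action of the real scalar c: *: is here the module
   structure of matrices over the ring of polynomials.
   Values of nu at matrices of degree > L are irrelevant. *)
Record is_norm_on_deg_le (L k : nat) (nu : 'M[{mpoly R[n]}]_k -> R) : Prop :=
  IsNormOnDegLe {
    norm_on_ge0 : forall A, mxdeg_le L A -> 0 <= nu A;
    norm_on_eq0 : forall A, mxdeg_le L A -> nu A = 0 -> A = 0;
    norm_on_scale : forall (c : R) A, mxdeg_le L A ->
      nu (c%:MP *: A) = `|c| * nu A;
    norm_on_triangle : forall A B, mxdeg_le L A -> mxdeg_le L B ->
      nu (A + B) <= nu A + nu B }.

Definition sos (k : nat) (S : 'M[{mpoly R[n]}]_k) : Prop :=
  exists (h : nat) (C : 'M[{mpoly R[n]}]_(h, k)), S = C^T *m C.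

Definition semialg_set (m : nat) (g : 'I_m -> {mpoly R[n]}) (x : 'rV[R]_n) :
  Prop := forall i, 0 <= (g i).@[x 0].

Definition quadratic_module (m : nat) (g : 'I_m -> {mpoly R[n]}) (k : nat)
    (A : 'M[{mpoly R[n]}]_k) : Prop :=
  exists (S0 : 'M[{mpoly R[n]}]_k) (S : 'I_m -> 'M[{mpoly R[n]}]_k),
    [/\ sos S0, forall i, sos (S i) & A = S0 + \sum_(i < m) g i *: S i].

Definition truncated_quadratic_module (m : nat) (g : 'I_m -> {mpoly R[n]})
    (k N : nat) (A : 'M[{mpoly R[n]}]_k) : Prop :=
  exists (S0 : 'M[{mpoly R[n]}]_k) (S : 'I_m -> 'M[{mpoly R[n]}]_k),
    [/\ sos S0 /\ mxdeg_le N S0,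
        forall i, sos (S i) /\ mxdeg_le N (g i *: S i)
      & A = S0 + \sum_(i < m) g i *: S i].

(* R[X] is identified with the 1 x 1 matrices over R[X]. *)
Definition archimedean (m : nat) (g : 'I_m -> {mpoly R[n]}) : Prop :=
  forall a : {mpoly R[n]}, exists N : nat,
    (0 < N)%N /\ quadratic_module g ((a + N%:R)%:M : 'M_1).

End MatrixPolynomials.

Definition psdmx (R : realType) (k : nat) (B : 'M[R]_k) : Prop :=
  B^T = B /\ forall v : 'cV[R]_k, 0 <= (v^T *m B *m v) 0 0.

Definition loewner_ge (R : realType) (k : nat) (B C : 'M[R]_k) : Prop :=
  psdmx (B - C).

(* Main.v *)
(** Only scalar certificates are needed, because a constant positive definite
    matrix is a Gram matrix. Boundedness modulo the quadratic module M is
    measured by c^2 - a^2 being in M, which is submultiplicative. If |t| <= 1/2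
    in that sense, then 1 - t is a limit of squares (iterate for the square
    root), so every product of such factors is a limit of squares, and becomes
    an element of M after adding any eta > 0. By the Archimedean property this
    applies to c + X_l and c - X_l for large c, hence to all Bernstein
    polynomials of the box [-c, c]^n. If A >= e I on the box, the Bernstein
    coefficients of A of high degree d are within O(1/d) of values of A on the
    box, hence positive definite; with a bound on the degree and coefficients of
    A, a single d and eta serve for all A, so only finitely many certificates
    occur and the degrees are uniform. To pass from S_g to the box one subtracts
    a scalar penalty q = w (sum_i g_i (1 - g_i / G)^(2p)) in M, which is tiny
    where all g_i >= 0 and very negative away from S_g. *)
Require Import Defs.
From HB Require Import structures.
From mathcomp Require Import all_boot all_order all_algebra.
From mathcomp Require Import mpoly.
From mathcomp Require Import boolp classical_sets reals topology normedtype derive.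
From mathcomp Require Import ring lra.

Set Implicit Arguments.
Unset Strict Implicit.
Unset Printing Implicit Defensive.

Import GRing.Theory Num.Theory Order.TTheory.
Import numFieldNormedType.Exports.
Local Open Scope ring_scope.

(** * Quadratic modules and norm bounds *)

Section SumsOfSquares.
Variables (R : realType) (n : nat).
Local Notation mp := {mpoly R[n]}.

Lemma sos0 k : sos (0 : 'M[mp]_k).
Proof. by exists 0%N, 0; rewrite mulmx0. Qed.

Lemma sos_add k (S T : 'M[mp]_k) : sos S -> sos T -> sos (S + T).
Proof.
move=> [h [C ->]] [h' [C' ->]]; exists (h + h')%N, (col_mx C C').
by rewrite tr_col_mx mul_row_col.
Qed.

Lemma sos_congr j k (S : 'M[mp]_j) (B : 'M[mp]_(j, k)) :
  sos S -> sos (B^T *m S *m B).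
Proof.
by move=> [h [C ->]]; exists h, (C *m B); rewrite trmx_mul !mulmxA.
Qed.

Lemma deg_le_add N (p q : mp) : deg_le N p -> deg_le N q -> deg_le N (p + q).
Proof.
by rewrite /deg_le => pN qN; apply: leq_trans (msizeD_le _ _) _; rewrite geq_max pN.
Qed.

Lemma deg_leW N N' (p : mp) : (N <= N')%N -> deg_le N p -> deg_le N' p.
Proof. by rewrite /deg_le => NN' /leq_trans -> //. Qed.

Lemma deg_le_sum N (I : finType) (P : pred I) (F : I -> mp) :
  (forall i, deg_le N (F i)) -> deg_le N (\sum_(i | P i) F i).
Proof.
move=> FN; elim/big_ind: _ => //; first by rewrite /deg_le msize0.
by move=> *; apply: deg_le_add.
Qed.

Lemma deg_leZ N c (p : mp) : deg_le N p -> deg_le N (c%:MP * p).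
Proof. by rewrite mul_mpolyC; apply: leq_trans (msizeZ_le _ _). Qed.

Lemma mxdeg_le_exists h k (A : 'M[mp]_(h, k)) : exists N, mxdeg_le N A.
Proof.
exists (\max_(ij : 'I_h * 'I_k) msize (A ij.1 ij.2))%N => i j.
exact: leqW (leq_bigmax (i, j)).
Qed.

Lemma mxdeg_leW N N' h k (A : 'M[mp]_(h, k)) :
  (N <= N')%N -> mxdeg_le N A -> mxdeg_le N' A.
Proof. by move=> NN' AN i j; apply: deg_leW (AN i j). Qed.

Lemma mxdeg_le_congr_const N j k (A : 'M[mp]_j) (B : 'M[R]_(j, k)) :
  mxdeg_le N A ->
  mxdeg_le N ((map_mx (@mpolyC n R) B)^T *m A *m map_mx (@mpolyC n R) B).
Proof.
move=> AN i l; rewrite !mxE; apply: deg_le_sum => s.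
rewrite !mxE mulr_suml; apply: deg_le_sum => t; rewrite !mxE.
by rewrite mulrC; do 2![apply: deg_leZ].
Qed.

End SumsOfSquares.

(** * Quadratic modules, bounds modulo them, and limits of squares *)

Section QuadraticModules.
Variables (R : realType) (n m : nat) (g : 'I_m -> {mpoly R[n]}).
Local Notation mp := {mpoly R[n]}.
Local Notation mpC := (@mpolyC n R).
Local Notation QM := (quadratic_module g).
Local Notation TQ := (truncated_quadratic_module g).

Lemma qm_truncated k (A : 'M[mp]_k) : QM A -> exists N, TQ N A.
Proof.
move=> [S0 [S [S0s Ss AE]]].
have [N0 N0P] := mxdeg_le_exists S0.
have /fin_all_exists[N NP] i := mxdeg_le_exists (g i *: S i).
exists (maxn N0 (\max_i N i)); exists S0, S; split=> //.
  by split=> //; apply: mxdeg_leW N0P; apply: leq_maxl.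
move=> i; split=> //; apply: mxdeg_leW (NP i).
by apply: leq_trans (leq_maxr _ _); apply: leq_bigmax.
Qed.

Lemma truncated_qm k N (A : 'M[mp]_k) : TQ N A -> QM A.
Proof.
by move=> [S0 [S [[S0s _] Ss AE]]]; exists S0, S; split=> // i; case: (Ss i).
Qed.

Lemma tqmW k N N' (A : 'M[mp]_k) : (N <= N')%N -> TQ N A -> TQ N' A.
Proof.
move=> NN' [S0 [S [[S0s S0N] Ss AE]]]; exists S0, S; split=> //.
  by split=> //; apply: mxdeg_leW S0N.
by move=> i; have [Si SN] := Ss i; split=> //; apply: mxdeg_leW SN.
Qed.

Lemma tqm0 k N : TQ N (0 : 'M[mp]_k).
Proof.
have d0 : mxdeg_le N (0 : 'M[mp]_k) by move=> i j; rewrite mxE /deg_le msize0.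
exists 0, (fun=> 0); split; first by split=> //; apply: sos0.
  by move=> i; rewrite scaler0; split=> //; apply: sos0.
by rewrite big1 ?addr0 // => i _; rewrite scaler0.
Qed.

Lemma tqm_add k N (A B : 'M[mp]_k) : TQ N A -> TQ N B -> TQ N (A + B).
Proof.
move=> [S0 [S [[S0s S0N] Ss ->]]] [T0 [T [[T0s T0N] Ts ->]]].
exists (S0 + T0), (fun i => S i + T i); split.
- by split; [apply: sos_add | move=> i j; rewrite mxE; apply: deg_le_add].
- move=> i; have [Si SN] := Ss i; have [Ti TN] := Ts i.
  split; first exact: sos_add.
  by rewrite scalerDr => a b; rewrite mxE; apply: deg_le_add.
- by under [X in _ = _ + X]eq_bigr do rewrite scalerDr; rewrite big_split addrACA.
Qed.

Lemma tqm_sum k N (I : finType) (F : I -> 'M[mp]_k) :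
  (forall i, TQ N (F i)) -> TQ N (\sum_i F i).
Proof.
by move=> FN; elim/big_ind: _ => //; [apply: tqm0 | apply: tqm_add].
Qed.

Lemma tqm_congr_const j k N (A : 'M[mp]_j) (B : 'M[R]_(j, k)) :
  TQ N A -> TQ N ((map_mx mpC B)^T *m A *m map_mx mpC B).
Proof.
move=> [S0 [S [[S0s S0N] Ss ->]]].
pose c (X : 'M[mp]_j) := (map_mx mpC B)^T *m X *m map_mx mpC B.
have cZ a X : a *: c X = c (a *: X) by rewrite /c -scalemxAr scalemxAl.
exists (c S0), (fun i => c (S i)); split.
- by split; [apply: sos_congr | apply: mxdeg_le_congr_const].
- move=> i; have [Si SN] := Ss i; split; first exact: sos_congr.
  by rewrite cZ; apply: mxdeg_le_congr_const.
- rewrite {1}/c mulmxDr mulmxDl; congr (_ + _).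
  by rewrite mulmx_sumr mulmx_suml; apply: eq_bigr => i _; rewrite cZ.
Qed.

(** [C^T *m C] is the sum over the rows of [C] of their rank-one squares, so the matrix is a sum of
    constant congruences of the 1 x 1 matrix [b], and these do not raise degrees. This turns scalar
    certificates into matrix ones. *)
Lemma tqm_const_gram h k N (b : mp) (C : 'M[R]_(h, k)) :
  TQ N (b%:M : 'M_1) -> TQ N (b *: map_mx mpC (C^T *m C)).
Proof.
move=> bN.
have -> : b *: map_mx mpC (C^T *m C) = \sum_(i < h)
    (map_mx mpC (row i C))^T *m (b%:M : 'M_1) *m map_mx mpC (row i C).
  apply/matrixP => s t; rewrite summxE !mxE rmorph_sum mulr_sumr.
  apply: eq_bigr => i _; rewrite !mxE big_ord1 !mxE big_ord1 !mxE mulr1n.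

  by rewrite rmorphM /= mulrCA mulrA.
by apply: tqm_sum => i; apply: tqm_congr_const.
Qed.

Lemma qm_add k (A B : 'M[mp]_k) : QM A -> QM B -> QM (A + B).
Proof.
move=> /qm_truncated[N AN] /qm_truncated[N' BN].
by apply: (@truncated_qm _ (maxn N N')); apply: tqm_add;
  [apply: tqmW AN; apply: leq_maxl | apply: tqmW BN; apply: leq_maxr].
Qed.

Lemma qm_congr j k (A : 'M[mp]_j) (B : 'M[mp]_(j, k)) :
  QM A -> QM (B^T *m A *m B).
Proof.
move=> [S0 [S [S0s Ss ->]]].
exists (B^T *m S0 *m B), (fun i => B^T *m S i *m B); split.
- exact: sos_congr.
- by move=> i; apply: sos_congr.
- rewrite mulmxDr mulmxDl mulmx_sumr mulmx_suml; congr (_ + _).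
  by apply: eq_bigr => i _; rewrite -scalemxAr -scalemxAl.
Qed.

Definition qms (a : mp) := QM (a%:M : 'M_1).

Lemma qms_add a b : qms a -> qms b -> qms (a + b).
Proof. by rewrite /qms raddfD; apply: qm_add. Qed.

Lemma qms_sqrM p a : qms a -> qms (p ^+ 2 * a).
Proof.
move=> /(@qm_congr 1 1 _ (p%:M)); rewrite /qms tr_scalar_mx -!scalar_mxM.
by rewrite mulrAC -expr2.
Qed.

Lemma qms_sqr p : qms (p ^+ 2).
Proof.
exists (p ^+ 2)%:M, (fun=> 0); split.
- by exists 1%N, p%:M; rewrite tr_scalar_mx -scalar_mxM -expr2.
- by move=> i; apply: sos0.
- by rewrite big1 ?addr0 // => i _; rewrite scaler0.
Qed.

Lemma qms_gen i : qms (g i).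
Proof.
exists 0, (fun j => (j == i)%:R%:M); split; first exact: sos0.
- move=> j; exists 1%N, (j == i)%:R%:M; rewrite tr_scalar_mx -scalar_mxM.
  by case: eqP => _; rewrite ?mul0r ?mul1r.
- rewrite add0r (bigD1 i) //= eqxx big1 ?addr0 ?scale_scalar_mx ?mulr1 //.
  by move=> j /negPf->; rewrite scale_scalar_mx mulr0 raddf0.
Qed.

Lemma qmsZ (c : R) a : 0 <= c -> qms a -> qms (c *: a).
Proof.
move=> c0 /(@qms_sqrM (Num.sqrt c)%:MP).
by rewrite -rmorphXn /= sqr_sqrtr // mul_mpolyC.
Qed.

Lemma qmsC (c : R) : 0 <= c -> qms (c%:MP).
Proof. by move=> c0; rewrite -(sqr_sqrtr c0) rmorphXn; apply: qms_sqr. Qed.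

Lemma qms_sum (I : finType) (F : I -> mp) :
  (forall i, qms (F i)) -> qms (\sum_i F i).
Proof.
move=> FN; elim/big_ind: _ => //; last exact: qms_add.
by rewrite -(rmorph0 mpC); apply: qmsC.
Qed.

(* [bnd c a] says that [|a| <= c] holds modulo the quadratic module; bounding
   the square rather than [a] itself is what makes it submultiplicative. *)
Definition bnd (c : R) (a : mp) := 0 < c /\ qms ((c ^+ 2)%:MP - a ^+ 2).

Lemma qms_bnd c a : bnd c a -> qms (c%:MP + a).
Proof.
move=> [c0 ca].
have -> : c%:MP + a =
    (c *+ 2)^-1 *: ((c%:MP + a) ^+ 2 + ((c ^+ 2)%:MP - a ^+ 2)).
  have -> : (c%:MP + a) ^+ 2 + ((c ^+ 2)%:MP - a ^+ 2) = (c *+ 2) *: (c%:MP + a).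
    by rewrite -mul_mpolyC mulr2n mpolyCD rmorphXn /=; ring.
  by rewrite scalerA mulVf ?scale1r // gt_eqF // mulrn_wgt0.
apply: qmsZ; first by rewrite invr_ge0 mulrn_wge0 ?ltW.
by apply: qms_add; [apply: qms_sqr|].
Qed.

Lemma bndN c a : bnd c a -> bnd c (- a).
Proof. by rewrite /bnd sqrrN. Qed.

(* (c + a)(c - a) * 2c = (c + a)^2 (c - a) + (c - a)^2 (c + a) *)
Lemma bndP c a : 0 < c -> qms (c%:MP - a) -> qms (c%:MP + a) -> bnd c a.
Proof.
move=> c0 cB cD; split=> //.
have -> : (c ^+ 2)%:MP - a ^+ 2 = (c *+ 2)^-1 *:
    ((c%:MP + a) ^+ 2 * (c%:MP - a) + (c%:MP - a) ^+ 2 * (c%:MP + a)).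
  have -> : (c%:MP + a) ^+ 2 * (c%:MP - a) + (c%:MP - a) ^+ 2 * (c%:MP + a)
    = (c *+ 2) *: ((c ^+ 2)%:MP - a ^+ 2).
    by rewrite -mul_mpolyC mulr2n mpolyCD rmorphXn /=; ring.
  by rewrite scalerA mulVf ?scale1r // gt_eqF // mulrn_wgt0.
apply: qmsZ; first by rewrite invr_ge0 mulrn_wge0 ?ltW.
by apply: qms_add; apply: qms_sqrM.
Qed.

Lemma bndD c d a b : bnd c a -> bnd d b -> bnd (c + d) (a + b).
Proof.
move=> ca db; apply: bndP; first by apply: addr_gt0; [case: ca | case: db].
  have := qms_add (qms_bnd (bndN ca)) (qms_bnd (bndN db)).
  by congr qms; rewrite mpolyCD; ring.
have := qms_add (qms_bnd ca) (qms_bnd db).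
by congr qms; rewrite mpolyCD; ring.
Qed.

Lemma bndM c d a b : bnd c a -> bnd d b -> bnd (c * d) (a * b).
Proof.
move=> [c0 ca] [d0 db]; split; first exact: mulr_gt0.
have -> : ((c * d) ^+ 2)%:MP - (a * b) ^+ 2 =
   a ^+ 2 * ((d ^+ 2)%:MP - b ^+ 2) + (d ^+ 2) *: ((c ^+ 2)%:MP - a ^+ 2).
  by rewrite -mul_mpolyC exprMn mpolyCM; ring.
by apply: qms_add; [apply: qms_sqrM | apply: qmsZ; rewrite ?sqr_ge0].
Qed.

Lemma bndW c d a : c <= d -> bnd c a -> bnd d a.
Proof.
move=> cd [c0 ca]; have d0 := lt_le_trans c0 cd; split=> //.
have -> : (d ^+ 2)%:MP - a ^+ 2 =
   (d ^+ 2 - c ^+ 2)%:MP + ((c ^+ 2)%:MP - a ^+ 2) by rewrite mpolyCB; ring.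
by apply: qms_add => //; apply: qmsC; rewrite subr_ge0 ler_sqr ?nnegrE // ltW.
Qed.

Lemma bndC c d : 0 < d -> `|c| <= d -> bnd d c%:MP.
Proof.
move=> d0 cd; split=> //; rewrite -rmorphXn -mpolyCB; apply: qmsC.
by rewrite subr_ge0 -(real_normK (num_real c)) ler_sqr ?nnegrE // ltW.
Qed.

Lemma bndZ c e a : 0 < c -> bnd e a -> bnd (c * e) (c *: a).
Proof.
move=> c0 ea; rewrite -mul_mpolyC; apply: bndM => //.
by apply: bndC; rewrite // gtr0_norm.
Qed.

(** Applied to [a] and to [- a], the Archimedean property gives two one-sided bounds; their sum
    serves on both sides. *)
Lemma bnd_exists : archimedean g -> forall a, exists c, bnd c a.
Proof.
move=> arch a; have [N [N0 aN]] := arch a; have [N' [N'0 aN']] := arch (- a).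
exists (N + N')%:R; apply: bndP; first by rewrite ltr0n addn_gt0 N0.
  have := qms_add aN' (qmsC (ler0n R N)); congr qms.
  by rewrite natrD mpolyCD !mpolyC_nat; ring.
have := qms_add aN (qmsC (ler0n R N')); congr qms.
by rewrite natrD mpolyCD !mpolyC_nat; ring.
Qed.

(* The iteration u <- (t + u^2) / 2 for 1 - sqrt (1 - t): it satisfies
   1 - t - (1 - u_n)^2 = 2 (u_n - u_(n+1)) and contracts at rate 1/2. *)
Lemma sqrt_approx t (eta : R) : bnd 2^-1 t -> 0 < eta ->
  exists p, bnd eta (1 - t - p ^+ 2).
Proof.
move=> tb eta0.
pose u i := iter i (fun w => 2^-1 *: (t + w ^+ 2)) 0.
have h0 : 0 < 2^-1 :> R by rewrite invr_gt0 ltr0n.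
have uS i : u i.+1 = 2^-1 *: (t + u i ^+ 2) by [].
(* The ball of radius 1/2 is invariant, as (1/2 + 1/4) / 2 <= 1/2; hence two consecutive iterates
   add up to at most 1 and each step halves the difference. *)
have ub i : bnd 2^-1 (u i).
  elim: i => [|i IH].
    by rewrite /u /= -(rmorph0 mpC); apply: bndC; rewrite // normr0 ltW.
  rewrite uS; have := bndZ h0 (bndD tb (bndM IH IH)).
  rewrite -expr2; apply: bndW; lra.
have du i : bnd (2^-1 ^+ i) (u i.+1 - u i).
  elim: i => [|i IH].
    rewrite expr0; apply: bndW (bndD (ub 1%N) (bndN (ub 0%N))); lra.
  have -> : u i.+2 - u i.+1 = 2^-1 *: ((u i.+1 - u i) * (u i.+1 + u i)).
    by rewrite 2!uS -!mul_mpolyC; ring.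
  have := bndZ h0 (bndM IH (bndD (ub i.+1) (ub i))).
  apply: bndW; rewrite exprSr.
  have : 0 < 2^-1 ^+ i :> R by rewrite exprn_gt0.
  lra.
have [N NP] : exists N, 2 * 2^-1 ^+ N <= eta.
  pose N := (Num.truncn (2 / eta)).+1; exists N.
  have NP : 2 / eta < N%:R by apply: truncnS_gt.
  have N2 : N%:R <= 2 ^+ N :> R by rewrite -natrX ler_nat ltnW // ltn_expl.
  rewrite exprVn ler_pdivrMr ?exprn_gt0 // mulrC -ler_pdivrMr //.
  exact: le_trans (ltW NP) N2.
exists (1 - u N).
have -> : 1 - t - (1 - u N) ^+ 2 = 2 *: - (u N.+1 - u N).
  have -> : t = 2 *: u N.+1 - u N ^+ 2.
    by rewrite uS scalerA divff ?pnatr_eq0 // scale1r; ring.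
  by rewrite -!mul_mpolyC mpolyC_nat; ring.
by apply: bndW (bndZ _ (bndN (du N))).
Qed.

(** Limits of squares in the sense of [bnd]. Boundedness is carried along because it multiplies the
    errors in a product. *)
Definition near_square a :=
  (exists c, bnd c a) /\ forall eta, 0 < eta -> exists p, bnd eta (a - p ^+ 2).

Lemma near_square_qms a eta : near_square a -> 0 < eta -> qms (a + eta%:MP).
Proof.
move=> [_ aP] /aP [p /qms_bnd /(qms_add (qms_sqr p))].
by congr qms; ring.
Qed.

Lemma near_squareM a b : near_square a -> near_square b -> near_square (a * b).
Proof.
move=> [[c ca] aP] [[d db] bP]; split; first by exists (c * d); apply: bndM.
move=> eta eta0.
have c0 : 0 < c by case: ca.
have d0 : 0 < d by case: db.
(* The accuracy 1 keeps [q ^+ 2] bounded by [d + 1]; the other accuracies make each of the two error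
   terms at most [eta / 2]. *)
have [q qP] : exists q, bnd (Num.min 1 (eta / (2 * c))) (b - q ^+ 2).
  by apply: bP; rewrite lt_min ltr01 divr_gt0 // mulr_gt0.
have [p pP] : exists p, bnd (eta / (2 * (d + 1))) (a - p ^+ 2).
  by apply: aP; rewrite divr_gt0 // mulr_gt0 // addr_gt0.
exists (p * q).
have -> : a * b - (p * q) ^+ 2 = a * (b - q ^+ 2) + (a - p ^+ 2) * q ^+ 2 by ring.
have qb : bnd (d + 1) (q ^+ 2).
  have -> : q ^+ 2 = b + - (b - q ^+ 2) by ring.
  by apply: bndD => //; apply: bndN; apply: bndW qP; rewrite ge_min lexx.
have qP' : bnd (eta / (2 * c)) (b - q ^+ 2).
  by apply: bndW qP; rewrite ge_min lexx orbT.
apply: bndW (bndD (bndM ca qP') (bndM pP qb)).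
have d10 : d + 1 != 0 by rewrite gt_eqF // addr_gt0.
have c_neq0 : c != 0 by rewrite gt_eqF.
by rewrite le_eqVlt; apply/orP; left; apply/eqP; field; apply/andP.
Qed.

Lemma near_squareC c : 0 <= c -> near_square c%:MP.
Proof.
move=> c0; split.
  by exists (c + 1); apply: bndC; rewrite ?ltr_wpDl // ger0_norm // lerDl.
move=> eta eta0; exists (Num.sqrt c)%:MP.
rewrite -rmorphXn /= sqr_sqrtr // subrr -(rmorph0 mpC).
by apply: bndC; rewrite // normr0 ltW.
Qed.

Lemma near_squareX a i : near_square a -> near_square (a ^+ i).
Proof.
move=> aP; elim: i => [|i IH]; last by rewrite exprS; apply: near_squareM.
by rewrite expr0 -(rmorph1 mpC); apply: near_squareC.
Qed.

Lemma near_square_prod (I : finType) (F : I -> mp) :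
  (forall i, near_square (F i)) -> near_square (\prod_i F i).
Proof.
move=> FP; elim/big_ind: _ => //; last exact: near_squareM.
by rewrite -(rmorph1 mpC); apply: near_squareC.
Qed.

Lemma near_square_1B t : bnd 2^-1 t -> near_square (1 - t).
Proof.
move=> tb; split=> [|eta eta0]; last exact: sqrt_approx.
exists (1 + 2^-1); apply: bndD (bndN tb).
by rewrite -(rmorph1 mpC); apply: bndC; rewrite // normr1.
Qed.

End QuadraticModules.

(** * Bernstein expansions *)

Section ProductEstimates.
Variable R : realFieldType.

(** Telescoping, one factor at a time. The bound on the product is proved jointly since the
    induction step multiplies an error by it. *)
Lemma dist_prod_le (I : Type) (r : seq I) (a b : I -> R) :
  (forall i, `|a i| <= 1) -> (forall i, `|b i| <= 1) ->
  `|\prod_(i <- r) a i| <= 1 /\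
  `|\prod_(i <- r) a i - \prod_(i <- r) b i| <= \sum_(i <- r) `|a i - b i|.
Proof.
move=> a1 b1; elim: r => [|i r [IH1 IH]].
  by rewrite !big_nil subrr normr0 normr1.
rewrite !big_cons normrM mulr_ile1 //; split=> //.
set x := \prod_(j <- r) a j in IH1 IH *; set y := \prod_(j <- r) b j in IH *.
have -> : a i * x - b i * y = (a i - b i) * x + b i * (x - y) by ring.
apply: le_trans (ler_normD _ _) _; rewrite !normrM; apply: lerD.
  by rewrite ler_piMr.
by apply: le_trans IH; rewrite ler_piMl.
Qed.

Lemma dist_exp_le (a b : R) s : `|a| <= 1 -> `|b| <= 1 ->
  `|a ^+ s - b ^+ s| <= s%:R * `|a - b|.
Proof.
move=> a1 b1.
have [_] := @dist_prod_le 'I_s (index_enum _) (fun=> a) (fun=> b) (fun=> a1) (fun=> b1).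
by rewrite !prodr_const sumr_const card_ord mulr_natl.
Qed.

End ProductEstimates.

(** * Univariate Bernstein coefficients *)

Section Bernstein.
Variable R : realFieldType.

(* [bern_coef s d i] is the coefficient of [x ^+ s] on the [i]-th Bernstein
   polynomial of degree [d] of the interval [-1, 1]. The recursion comes from
   x = u - v with u = (1 + x) / 2 and v = (1 - x) / 2. It is only meaningful
   for [s <= d] and [i <= d]. *)
Fixpoint bern_coef (s d i : nat) : R :=
  if s is s'.+1 then
    i%:R / d%:R * bern_coef s' d.-1 i.-1 -
    (d - i)%:R / d%:R * bern_coef s' d.-1 i
  else 1.

Lemma bern_coefS s d i : bern_coef s.+1 d i =
  i%:R / d%:R * bern_coef s d.-1 i.-1 - (d - i)%:R / d%:R * bern_coef s d.-1 i.
Proof. by []. Qed.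

(** The uniform grid of [-1, 1]; for [d = 0] division by zero makes the only node -1. *)
Definition bern_node (d i : nat) : R := 2 * i%:R / d%:R - 1.

(** The homogeneous Bernstein form in [u] and [v], which is the usual Bernstein polynomial once
    [u + v = 1]. *)
Definition bern (T : comAlgType R) (u v : T) (d i : nat) : T :=
  'C(d, i)%:R *: (u ^+ i * v ^+ (d - i)).

Arguments bern : simpl never.

Lemma mulr_bernl (T : comAlgType R) (u v : T) d i :
  u * bern u v d i = (i.+1%:R / d.+1%:R) *: bern u v d.+1 i.+1.
Proof.
rewrite /bern subSS exprS -scalerAr scalerA mulrA; congr (_ *: _).
by rewrite mulrAC -natrM -mul_bin_diag natrM mulrAC divff ?pnatr_eq0 ?mul1r.
Qed.

Lemma mulr_bernr (T : comAlgType R) (u v : T) d i : (i <= d)%N ->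
  v * bern u v d i = ((d.+1 - i)%:R / d.+1%:R) *: bern u v d.+1 i.
Proof.
move=> id; rewrite /bern -scalerAr scalerA mulrCA -exprS -subSn //.
congr (_ *: _).
by rewrite mulrAC -natrM -mul_bin_down natrM mulrAC divff ?pnatr_eq0 ?mul1r.
Qed.

(** Multiplying the expansion for [s] by [u - v] lifts every Bernstein form by one degree, with the
    weights of [mulr_bernl] and [mulr_bernr]; collecting terms gives exactly the recursion of
    [bern_coef]. *)
Lemma sum_bern (T : comAlgType R) (u v : T) s d : (s <= d)%N ->
  \sum_(i < d.+1) bern_coef s d i *: bern u v d i = (u - v) ^+ s * (u + v) ^+ (d - s).
Proof.
elim: s d => [|s IH] d.
  move=> _; rewrite subn0 expr0 mul1r addrC exprDn; apply: eq_bigr => i _.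
  by rewrite scale1r /bern scaler_nat mulrC.
case: d => // d sd; rewrite subSS exprS -mulrA -IH //.
rewrite mulr_sumr.
under [RHS]eq_bigr => i _ do
  rewrite -scalerAr mulrBl mulr_bernl mulr_bernr ?leq_ord // scalerBr.
rewrite sumrB; under eq_bigr do rewrite bern_coefS scalerBl.
rewrite sumrB; congr (_ - _).
  (* The values of [bern_coef] outside its range never count: here the term of index 0 has weight 0,
     and below the term of top index does. *)
  rewrite big_ord_recl !mul0r scale0r add0r; apply: eq_bigr => i _.
  by rewrite lift0 [RHS]scalerA [X in _ = X *: _]mulrC.
rewrite big_ord_recr /= subnn !mul0r scale0r addr0; apply: eq_bigr => i _.
by rewrite [RHS]scalerA [X in _ = X *: _]mulrC.
Qed.

Lemma convex_nat d i : (i <= d.+1)%N ->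
  (d.+1 - i)%:R / d.+1%:R = 1 - i%:R / d.+1%:R :> R.
Proof. by move=> id; rewrite natrB // mulrBl divff ?pnatr_eq0. Qed.

Lemma nat_ratio_itv d i : (i <= d)%N -> 0 <= (i%:R / d%:R : R) <= 1.
Proof.
move=> id; rewrite divr_ge0 ?ler0n //=.
case: d id => [|d] id; first by rewrite invr0 mulr0.
by rewrite ler_pdivrMr ?ltr0n // mul1r ler_nat.
Qed.

Lemma bern_coef_le1 s d i : (i <= d)%N -> `|bern_coef s d i| <= 1.
Proof.
elim: s d i => [|s IH] d i id /=; first by rewrite normr1.
case: d id => [|d] id.
  by rewrite invr0 !mulr0 !mul0r subrr normr0.
rewrite convex_nat //; have /andP[a0 a1] := nat_ratio_itv id.
(* For [i = d.+1] the second recursive value is out of range, but its weight vanishes. Otherwise the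
   weights are convex. *)
case: (ltngtP i d.+1) id => // [id _|-> _]; last first.
  rewrite divff ?pnatr_eq0 // subrr mul0r subr0 mul1r /=; exact: IH.
have [+ +] := (IH d i id, IH d i.-1 (leq_trans (leq_pred i) id)).
move: a0 a1; set a := _ / _; rewrite !ler_norml => a0 a1 /andP[x1 x2] /andP[y1 y2].
by apply/andP; split; nra.
Qed.

Lemma bern_node_le1 d i : (i <= d)%N -> `|bern_node d i| <= 1.
Proof.
move=> id; have /andP[] := nat_ratio_itv id.
by rewrite /bern_node -mulrA ler_norml => *; apply/andP; split; lra.
Qed.

Lemma dist_bern_node d i j : (j <= d)%N -> (j <= i <= j.+1)%N ->
  `|bern_node d j - bern_node d.+1 i| <= 2 / d.+1%:R.
Proof.
move=> jd /andP[ji ij]; rewrite /bern_node.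
have d1 : 0 < d.+1%:R :> R by rewrite ltr0n.
case: d jd d1 => [|d] jd d1.
  move: jd ij d1; rewrite leqn0 => /eqP-> ij _; move: i ij {ji} => [|[|]] //= _;
    by rewrite ler_norml; apply/andP; split; lra.
have d0 : 0 < d.+1%:R :> R by rewrite ltr0n.
have jd' : j%:R <= d.+1%:R :> R by rewrite ler_nat.
have j0 : 0 <= j%:R :> R by rewrite ler0n.
have dS : d.+2%:R = d.+1%:R + 1 :> R by rewrite -natr1.
(* The inner numerator is [j] or [j - d.+1], according to whether [i] is [j] or [j.+1]; it is at
   most [d.+1] in absolute value. *)
have -> : 2 * j%:R / d.+1%:R - 1 - (2 * i%:R / d.+2%:R - 1) =
    2 * ((j%:R - (i%:R - j%:R) * d.+1%:R) / d.+1%:R) / d.+2%:R :> R.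
  rewrite dS; move: (d.+1%:R) (i%:R) (j%:R) d0 => D a b D0; field.
  by apply/andP; split; lra.
rewrite normrM [`|_^-1|]ger0_norm ?invr_ge0 ?ler0n // ler_wpM2r ?invr_ge0 ?ler0n //.
rewrite normrM ger0_norm // -[leRHS]mulr1 ler_wpM2l //.
rewrite normrM [`|_^-1|]ger0_norm ?invr_ge0 ?ler0n // ler_pdivrMr // mul1r ler_norml.
have: (i == j) || (i == j.+1) by rewrite !eqn_leq ji ij /= ltnNge andbT orbN.
by case/orP => /eqP->; rewrite ?subrr -?natr1; apply/andP; split; lra.
Qed.

(** Write a for i / d, so that the node is y = a - (1 - a). The recursion weighs two values close to
    [y ^+ s] by a and - (1 - a), so the result is close to [y ^+ s.+1], and the errors are averaged.
    Passing to the grid of one degree less moves the nodes by O(1/d), which costs the term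
    [2 * s%:R]. *)
Lemma bern_coef_approx : exists C : nat -> R, (forall s, 0 <= C s) /\
  forall s d i, (s <= d)%N -> (i <= d)%N ->
    `|bern_coef s d i - bern_node d i ^+ s| <= C s / d.+1%:R.
Proof.
pose C := fix C s : R := if s is s'.+1 then 2 * (C s' + 2 * s'%:R) else 0.
have C0 s : 0 <= C s.
  by elim: s => //= s IH; rewrite mulr_ge0 // addr_ge0 // mulr_ge0 // ler0n.
exists C; split=> //; elim=> [|s IH] d i; first by rewrite subrr normr0 mul0r.
case: d => // d sd id /=.
rewrite convex_nat //; have /andP[a0 a1] := nat_ratio_itv id.
have yE : bern_node d.+1 i = 2 * (i%:R / d.+1%:R) - 1 by rewrite /bern_node mulrA.
set y := bern_node d.+1 i in yE *; set a := i%:R / d.+1%:R in a0 a1 yE *.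
have step j : (j <= d)%N -> (j <= i <= j.+1)%N ->
    `|bern_coef s d j - y ^+ s| <= (C s + 2 * s%:R) / d.+1%:R.
  move=> jd ij.
  have -> : bern_coef s d j - y ^+ s =
    bern_coef s d j - bern_node d j ^+ s + (bern_node d j ^+ s - y ^+ s) by ring.
  apply: le_trans (ler_normD _ _) _; rewrite mulrDl; apply: lerD; first exact: IH.
  apply: le_trans (dist_exp_le _ _ _) _; try exact: bern_node_le1.
  by rewrite [2 * s%:R]mulrC -[leRHS]mulrA ler_wpM2l ?ler0n // dist_bern_node.
set K := (C s + 2 * s%:R) / d.+1%:R in step *.
(* The factor 2 in the definition of [C] pays for replacing [d.+1] by [d.+2] in the denominator. *)
have KC : K <= 2 * (C s + 2 * s%:R) / d.+2%:R.
  rewrite [2 * (_ + _)]mulrC -mulrA /K ler_wpM2l ?addr_ge0 ?mulr_ge0 ?ler0n //.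
  rewrite ler_pdivlMr ?ltr0n // mulrC ler_pdivrMr ?ltr0n // -natrM ler_nat.
  by rewrite mul2n -addnn addSn addnS !ltnS leq_addl.
apply: le_trans KC.
have -> : a * bern_coef s d i.-1 - (1 - a) * bern_coef s d i - y ^+ s.+1 =
   a * (bern_coef s d i.-1 - y ^+ s) - (1 - a) * (bern_coef s d i - y ^+ s).
  by rewrite exprS yE; ring.
have H1 : `|a * (bern_coef s d i.-1 - y ^+ s)| <= a * K.
  rewrite normrM ger0_norm //.
  case: (posnP i) => [i0|i0]; first by rewrite /a i0 !mul0r.
  rewrite ler_wpM2l // step //; first by rewrite -ltnS prednK.
  by rewrite prednK // leq_pred leqnn.
have H2 : `|(1 - a) * (bern_coef s d i - y ^+ s)| <= (1 - a) * K.
  rewrite normrM ger0_norm ?subr_ge0 //.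
  case: (ltngtP i d.+1) id => // [id _|id _]; last first.
    by rewrite /a id divff ?pnatr_eq0 // subrr !mul0r.
  by rewrite ler_wpM2l ?subr_ge0 // step // leqnn leqnSn.
apply: le_trans (ler_normB _ _) _; apply: le_trans (lerD H1 H2) _.
by rewrite -mulrDl addrC subrK mul1r.
Qed.

End Bernstein.

(** * Tensor Bernstein expansions on a box *)

Section TensorBernstein.
Variables (R : realType) (n : nat) (c : R) (c_gt0 : 0 < c).
Local Notation mp := {mpoly R[n]}.

Definition bern_box (d : nat) (al : {ffun 'I_n -> 'I_d.+1}) : mp :=
  \prod_(l < n) bern (2^-1 *: (1 + c^-1 *: 'X_l)) (2^-1 *: (1 - c^-1 *: 'X_l)) d (al l).

Definition bern_box_coef (D d : nat) (p : mp) (al : {ffun 'I_n -> 'I_d.+1}) : R :=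
  \sum_(ga : 'X_{1..n < D.+1})
    p@_ga * \prod_(l < n)
      (c ^+ (ga : 'X_{1..n}) l * bern_coef R ((ga : 'X_{1..n}) l) d (al l)).

Definition bern_box_node (d : nat) (al : {ffun 'I_n -> 'I_d.+1}) : 'rV[R]_n :=
  \row_l (c * bern_node R d (al l)).

Lemma mnm_leq_mdeg (ga : 'X_{1..n}) l : (ga l <= mdeg ga)%N.
Proof. by rewrite mdegE (bigD1 l) //= leq_addr. Qed.

(** Every monomial splits over the coordinates, and each factor is expanded by [sum_bern] with u + v
    = 1 and u - v = X_l / c. The powers of [c] in [bern_box_coef] undo this scaling. *)
Lemma bern_boxE D d (p : mp) : deg_le D p -> (D <= d)%N ->
  p = \sum_(al : {ffun 'I_n -> 'I_d.+1}) bern_box_coef D p al *: bern_box al.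
Proof.
move=> pD Dd; rewrite {1}(mpolywE pD).
under [RHS]eq_bigr do rewrite scaler_suml.
rewrite exchange_big /=; apply: eq_bigr => ga _.
under [RHS]eq_bigr do rewrite -scalerA.
rewrite -scaler_sumr; congr (_ *: _); rewrite mpolyXE_id.
under [RHS]eq_bigr do rewrite -scaler_prod.
rewrite -(bigA_distr_bigA (fun l (i : 'I_d.+1) =>
  (c ^+ (ga : 'X_{1..n}) l * bern_coef R ((ga : 'X_{1..n}) l) d i) *:
    bern (2^-1 *: (1 + c^-1 *: 'X_l)) (2^-1 *: (1 - c^-1 *: 'X_l)) d i)).
apply: eq_bigr => l _.
under eq_bigr do rewrite -scalerA.
have gd : ((ga : 'X_{1..n}) l <= d)%N.
  apply: leq_trans (mnm_leq_mdeg _ _) (leq_trans _ Dd).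
  by rewrite -ltnS bmdeg.
rewrite -scaler_sumr sum_bern //.
have half (a : mp) : 2^-1 *: (a + a) = a.
  have h2 : 2^-1 + 2^-1 = 1 :> R by lra.
  by rewrite scalerDr -scalerDl h2 scale1r.
have -> : 2^-1 *: (1 + c^-1 *: 'X_l) + 2^-1 *: (1 - c^-1 *: 'X_l) = 1 :> mp.
  by rewrite -scalerDr addrACA subrr addr0.
have -> : 2^-1 *: (1 + c^-1 *: 'X_l) - 2^-1 *: (1 - c^-1 *: 'X_l) = c^-1 *: 'X_l :> mp.
  by rewrite -scalerBr opprB [1 + _]addrC addrACA subrr addr0.
rewrite expr1n mulr1 exprZn scalerA -exprMn mulfV ?gt_eqF // expr1n scale1r //.
Qed.

(** Monomial by monomial, the product of the [bern_coef] is compared with the product of node powers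
    through [dist_prod_le]. The constant depends on neither [d] nor [p], which makes one degree [d]
    usable for all matrices. *)
Lemma bern_box_coef_approx D K : 0 <= K -> exists C, 0 <= C /\
  forall d (p : mp), (D <= d)%N -> deg_le D p ->
    (forall ga, `|p@_ga| <= K) ->
    forall al : {ffun 'I_n -> 'I_d.+1},
      `|bern_box_coef D p al| <= C /\
      `|bern_box_coef D p al - p.@[bern_box_node al 0]| <= C / d.+1%:R.
Proof.
move=> K0; have [E [E0 EP]] := bern_coef_approx R.
pose cga (ga : 'X_{1..n < D.+1}) := \prod_(l < n) (c ^+ (ga : 'X_{1..n}) l).
have cga0 ga : 0 <= cga ga by apply: prodr_ge0 => l _; rewrite exprn_ge0 // ltW.
pose C1 := \sum_(ga : 'X_{1..n < D.+1}) K * cga ga.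
pose C2 := \sum_(ga : 'X_{1..n < D.+1})
  K * (cga ga * \sum_(l < n) E ((ga : 'X_{1..n}) l)).
have C10 : 0 <= C1 by apply: sumr_ge0 => ga _; apply: mulr_ge0.
have C20 : 0 <= C2.
  apply: sumr_ge0 => ga _; do 2![apply: mulr_ge0 => //]; exact: sumr_ge0.
exists (C1 + C2); split=> [|d p Dd pD pK al]; first exact: addr_ge0.
have gd (ga : 'X_{1..n < D.+1}) l : ((ga : 'X_{1..n}) l <= d)%N.
  apply: leq_trans (mnm_leq_mdeg _ _) (leq_trans _ Dd).
  by rewrite -ltnS bmdeg.
have W1 (ga : 'X_{1..n < D.+1}) l : `|bern_coef R ((ga : 'X_{1..n}) l) d (al l)| <= 1.
  by rewrite bern_coef_le1 // leq_ord.
have y1 (ga : 'X_{1..n < D.+1}) l : `|bern_node R d (al l) ^+ (ga : 'X_{1..n}) l| <= 1.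
  by rewrite normrX exprn_ile1 ?bern_node_le1 // leq_ord.
split.
  apply: le_trans (ler_norm_sum _ _ _) _.
  apply: (@le_trans _ _ C1); last by rewrite lerDl.
  apply: ler_sum => ga _; rewrite normrM big_split /= normrM (ger0_norm (cga0 ga)).
  apply: ler_pM => //; first exact: mulr_ge0.
  have [H _] := dist_prod_le (index_enum _) (W1 ga) (W1 ga).
  by rewrite ler_piMr.
have -> : p.@[bern_box_node al 0] = \sum_(ga : 'X_{1..n < D.+1})
    p@_ga * (cga ga * \prod_(l < n) bern_node R d (al l) ^+ (ga : 'X_{1..n}) l).
  rewrite {1}(mpolywE pD) raddf_sum /=; apply: eq_bigr => ga _.
  rewrite mevalZ mevalX -big_split /=; congr (_ * _); apply: eq_bigr => l _.
  by rewrite mxE exprMn.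
rewrite -sumrB; apply: le_trans (ler_norm_sum _ _ _) _.
apply: (@le_trans _ _ (C2 / d.+1%:R));
  last by rewrite ler_wpM2r ?invr_ge0 ?ler0n // lerDr.
rewrite mulr_suml; apply: ler_sum => ga _.
rewrite -mulrBr normrM -mulrA; apply: ler_pM => //.
rewrite big_split /= -mulrBr normrM (ger0_norm (cga0 ga)) -mulrA ler_wpM2l //.
have [_ H] := dist_prod_le (index_enum _) (W1 ga) (y1 ga).
apply: le_trans H _; rewrite mulr_suml; apply: ler_sum => l _.
by apply: EP; rewrite ?leq_ord.
Qed.

End TensorBernstein.

(** * Positive definite matrices *)

Section PositiveDefinite.
Variable R : realType.

Definition qform k (P : 'M[R]_k) (v : 'cV[R]_k) : R := (v^T *m P *m v) 0 0.

Lemma qformD k (P Q : 'M[R]_k) v : qform (P + Q) v = qform P v + qform Q v.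
Proof. by rewrite /qform mulmxDr mulmxDl mxE. Qed.

Lemma qformN k (P : 'M[R]_k) v : qform (- P) v = - qform P v.
Proof. by rewrite /qform mulmxN mulNmx mxE. Qed.

Lemma qform_scalar k (a : R) (v : 'cV[R]_k) :
  qform a%:M v = a * \sum_i v i 0 ^+ 2.
Proof.
rewrite /qform mul_mx_scalar -scalemxAl mxE; congr (_ * _); rewrite mxE.
by apply: eq_bigr => i _; rewrite mxE.
Qed.

Lemma sqr_norm_gt0 k (v : 'cV[R]_k) : v != 0 -> 0 < \sum_i v i 0 ^+ 2.
Proof.
move=> v0; rewrite lt_neqAle sumr_ge0 ?andbT => [|i _]; last exact: sqr_ge0.
apply: contraNneq v0 => /esym/eqP.
rewrite psumr_eq0 => [/allP v0|i _]; last exact: sqr_ge0.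
apply/eqP/matrixP => i j; rewrite ord1 mxE.
by apply/eqP; rewrite -sqrf_eq0; apply: v0; rewrite mem_index_enum.
Qed.

(** Uses |v_i v_j| <= (v_i^2 + v_j^2) / 2; summing over all pairs of indices yields the factor
    [k]. *)
Lemma qform_bound k (P : 'M[R]_k) e v : (forall i j, `|P i j| <= e) ->
  `|qform P v| <= k%:R * e * \sum_i v i 0 ^+ 2.
Proof.
move=> Pe.
have -> : qform P v = \sum_j \sum_i v i 0 * P i j * v j 0.
  rewrite /qform mxE; apply: eq_bigr => j _; rewrite mxE mulr_suml.
  by apply: eq_bigr => i _; rewrite mxE.
apply: le_trans (ler_norm_sum _ _ _) _.
have -> : k%:R * e * \sum_i v i 0 ^+ 2 =
    \sum_j \sum_i (e * (v i 0 ^+ 2 / 2 + v j 0 ^+ 2 / 2)).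
  have S : \sum_(j < k) \sum_(i < k) e * (v i 0 ^+ 2 / 2) =
      k%:R * e * (\sum_i v i 0 ^+ 2) / 2.
    by rewrite sumr_const card_ord -mulr_sumr -mulr_suml mulr_natl -mulrnAl; ring.
  transitivity (\sum_(j < k) \sum_(i < k) e * (v i 0 ^+ 2 / 2) +
      \sum_(i < k) \sum_(j < k) e * (v j 0 ^+ 2 / 2)); first by rewrite S; field.
  rewrite [X in _ + X]exchange_big -big_split; apply: eq_bigr => j _.
  by rewrite -big_split; apply: eq_bigr => i _; rewrite mulrDr.
apply: ler_sum => j _; apply: le_trans (ler_norm_sum _ _ _) _.
apply: ler_sum => i _; rewrite !normrM mulrAC mulrC.
apply: ler_pM => //; first by rewrite mulr_ge0.
rewrite -(real_normK (num_real (v i 0))) -(real_normK (num_real (v j 0))).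
have := sqr_ge0 (`|v i 0| - `|v j 0|); lra.
Qed.

Definition posdef k (P : 'M[R]_k) := P^T = P /\ forall v, v != 0 -> 0 < qform P v.

(** Cholesky factorization by induction on the size, splitting off the first row and column. *)
Lemma posdef_gram k (P : 'M[R]_k) : posdef P -> exists C : 'M[R]_k, P = C^T *m C.
Proof.
elim: k P => [|k IH] P; first by exists 0; apply/matrixP; case.
rewrite -[k.+1]/(1 + k)%N in P *.
rewrite -[P]submxK; set a := ulsubmx P; set b := ursubmx P.
set b' := dlsubmx P; set D := drsubmx P.
move=> [Ps Pp].
have [as_ bE cE Ds] : [/\ a^T = a, b'^T = b, b^T = b' & D^T = D].
  by move: Ps; rewrite tr_block_mx => /eq_block_mx [].
pose al := a 0 0.
have aE : a = al%:M by rewrite [LHS]mx11_scalar.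
have qE (x : 'M[R]_1) (w : 'cV[R]_k) : qform (block_mx a b b' D) (col_mx x w) =
    (x^T *m a *m x + w^T *m b' *m x + x^T *m b *m w + w^T *m D *m w) 0 0.
  rewrite /qform tr_col_mx mul_row_block mul_row_col !mulmxDl.
  by congr (fun_of_matrix _ _ _); rewrite !addrA.
have al0 : 0 < al.
  have /Pp : col_mx (1%:M : 'M[R]_1) (0 : 'cV[R]_k) != 0.
    by rewrite col_mx_eq0 negb_and (oner_neq0 'M[R]_1).
  by rewrite qE !(trmx1, trmx0, mulmx1, mul1mx, mulmx0, mul0mx, addr0).
(* The Schur complement of the pivot [al] is again positive definite: its value at [w] is the value
   of the form at the vector over [w] whose first coordinate minimizes it. *)
have [C CE] : exists C : 'M[R]_k, D - al^-1 *: (b' *m b) = C^T *m C.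
  apply: IH; split.
    by rewrite raddfB /= linearZ /= trmx_mul bE cE Ds.
  move=> w w0.
  have /Pp : col_mx (- al^-1 *: (b *m w)) w != 0 by rewrite col_mx_eq0 negb_and w0 orbT.
  rewrite qE /qform aE; congr (0 < fun_of_matrix _ _ _).
  rewrite [(_ *: _)^T]linearZ /= trmx_mul cE mul_mx_scalar !mulmxBr !mulmxBl.
  rewrite -!(scalemxAl, scalemxAr) !mulmxA !scalerA.
  rewrite -!scalerDl [RHS]addrC -scaleNr; congr (_ *: _ + _); field.
  by rewrite gt_eqF.
exists (block_mx (Num.sqrt al)%:M ((Num.sqrt al)^-1 *: b) 0 C).
have r0 : Num.sqrt al != 0 by rewrite gt_eqF // sqrtr_gt0.
rewrite tr_block_mx mulmx_block !trmx0 !mul0mx !mulmx0 !addr0 -CE.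
rewrite tr_scalar_mx -scalar_mxM -expr2 sqr_sqrtr ?ltW // -aE.
rewrite mul_scalar_mx scalerA divff // scale1r [(_ *: _)^T]linearZ /= cE.
rewrite mul_mx_scalar scalerA.
rewrite divff // scale1r -scalemxAl -scalemxAr scalerA -invfM -expr2 sqr_sqrtr ?ltW //.
by rewrite addrC subrK.
Qed.

End PositiveDefinite.

(** * Compactness *)

Section Compactness.
Local Open Scope classical_set_scope.
Variable R : realType.

Lemma compact_min_gt0 n (A : set 'rV[R]_n) (f : 'rV[R]_n -> R) :
  compact A -> continuous f -> (forall x, A x -> 0 < f x) ->
  exists2 d, 0 < d & forall x, A x -> d <= f x.
Proof.
move=> Ac fc fA; have [->|/set0P A0] := eqVneq A set0.
  by exists 1 => // x [].
have [x + xmin] := compact_EVT_min A0 Ac (continuous_subspaceT fc).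
rewrite inE => Ax; exists (f x); first exact: fA.
by move=> y Ay; apply: xmin; rewrite inE.
Qed.

Lemma lipschitz_continuous n (f : 'rV[R]_n -> R) C :
  (forall v w, `|f v - f w| <= C * `|v - w|) -> continuous f.
Proof.
move=> fC v; apply/(@cvgrPdist_lt _ _ _ (nbhs v)) => e e0; apply/nbhs_ballP.
have C1 : 0 < `|C| + 1 by rewrite ltr_wpDl.
exists (e / (`|C| + 1)); first exact: divr_gt0.
move=> w; rewrite -ball_normE /= ltr_pdivlMr // => vw.
apply: le_lt_trans vw; apply: le_trans (fC _ _) _.
by rewrite mulrC ler_wpM2l // (le_trans (ler_norm C)) // lerDl.
Qed.

Lemma rV_norm_le n (x : 'rV[R]_n) c : 0 <= c ->
  (`|x| <= c) <-> (forall i, `|x 0 i| <= c).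
Proof.
move=> c0; rewrite /Num.norm /= mx_normrE; split=> [/bigmax_leP[_ H] i|H].
  exact: (H (0, i)).
by apply/bigmax_leP; split=> // -[i j] _ /=; rewrite ord1; apply: H.
Qed.

Lemma box_compact n (c : R) :
  compact [set x : 'rV[R]_n | forall i, `|x 0 i| <= c].
Proof.
have -> : [set x : 'rV[R]_n | forall i, `|x 0 i| <= c] =
    [set x | forall i, `[- c, c]%classic (x ord0 i)].
  by apply/seteqP; split=> x xc i; move: (xc i); rewrite /= in_itv /= ler_norml.
by apply: (@rV_compact _ n (fun=> `[- c, c]%classic)) => i; apply: segment_compact.
Qed.

Lemma meval_continuous n (p : {mpoly R[n]}) :
  continuous (fun x : 'rV[R]_n => p.@[x 0]).
Proof.
have cM (f h : 'rV[R]_n -> R) : continuous f -> continuous h -> continuous (f \* h).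
  by move=> fc hc x; apply: continuousM; [apply: fc | apply: hc].
have cX i k : continuous (fun x : 'rV[R]_n => x 0 i ^+ k).
  elim: k => [|k IH]; first exact: cst_continuous.
  have -> : (fun x : 'rV[R]_n => x 0 i ^+ k.+1) =
      (fun x : 'rV[R]_n => x 0 i) \* (fun x : 'rV[R]_n => x 0 i ^+ k).
    by apply/funext => x; rewrite exprS.
  by apply: cM => //; apply: coord_continuous.
have cP (m : 'X_{1..n}) : continuous (fun x : 'rV[R]_n => \prod_i x 0 i ^+ m i).
  by apply: continuous_big => [|i _]; [exact: mul_continuous | exact: cX].
have -> : (fun x : 'rV[R]_n => p.@[x 0]) =
    (fun x : 'rV[R]_n => \sum_(m <- msupp p) p@_m * \prod_i x 0 i ^+ m i).
  by apply/funext => x; rewrite mevalE.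
apply: continuous_big => [|m _]; first exact: add_continuous.
by apply: (cM (fun=> p@_m)) => //; apply: cst_continuous.
Qed.

(** The points of the box at distance at least [eta] from the semialgebraic set form a compact set,
    on which the total violation of the constraints is continuous and positive, hence bounded
    below. *)
Lemma far_from_semialg n m (g : 'I_m -> {mpoly R[n]}) (c eta : R) : 0 < eta ->
  exists2 d, 0 < d & forall x : 'rV[R]_n, (forall i, `|x 0 i| <= c) ->
    (forall i, - d < (g i).@[x 0]) ->
    exists2 y, semialg_set g y & forall i, `|x 0 i - y 0 i| <= eta.
Proof.
move=> eta0.
pose B := [set x : 'rV[R]_n | forall i, `|x 0 i| <= c].
pose F := \bigcap_(y in [set y | semialg_set g y]) [set x : 'rV[R]_n | eta <= `|x - y|].
have cF : compact (B `&` F).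
  apply: (@subclosed_compact _ _ _ _ (@box_compact n c)); last by move=> x [].
  apply: closedI; first exact: (compact_closed (@norm_hausdorff _ _) (@box_compact n c)).
  apply: closed_bigI => y _.
  apply: (@preimage_closed _ _ (fun x : 'rV[R]_n => `|x - y|) [set r | eta <= r]);
    last exact: closed_ge.
  move=> x _; apply: (@lipschitz_continuous _ _ 1) => v w.
  rewrite mul1r; apply: le_trans (ler_dist_dist _ _) _.
  by rewrite opprB addrA subrK.
(* Twice the sum of the negative parts of the [g i]. *)
pose f (x : 'rV[R]_n) := \sum_i (`|(g i).@[x 0]| - (g i).@[x 0]).
have f0 (x : 'rV[R]_n) i : 0 <= `|(g i).@[x 0]| - (g i).@[x 0].
  by rewrite subr_ge0 ler_norm.
have fc : continuous f.
  apply: continuous_big => [|i _ x]; first exact: add_continuous.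
  have gc : {for x, continuous (fun x : 'rV[R]_n => (g i).@[x 0])}.
    exact: meval_continuous.
  apply: (continuousB _ gc).
  apply: (@continuous_comp _ _ _ (fun x : 'rV[R]_n => (g i).@[x 0])
    (fun r : R => `|r|)) => //.
  exact: norm_continuous.
have [x [Bx Fx]|d d0 dP] := compact_min_gt0 cF fc.
  rewrite lt_neqAle sumr_ge0 // andbT eq_sym; apply/negP.
  rewrite psumr_eq0 // => /allP fx0.
  suff /Fx : semialg_set g x by rewrite /= subrr normr0 leNgt eta0.
  move=> i; have := fx0 i (mem_index_enum i); rewrite subr_eq0 => /eqP <-.
  exact: normr_ge0.
(* Each of the [m] terms of [f] is then at most [d / m.+1%:R], so that [f] stays strictly below
   [d]. *)
exists (d / (2 * m.+1%:R)) => [|x Bx gx].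
  by rewrite divr_gt0 // mulr_gt0 // ltr0n.
apply: contrapT => noy.
have /dP : (B `&` F) x.
  split=> // y yS; apply/ltW; rewrite ltNge; apply/negP => xy; apply: noy.
  exists y => // i; have /(_ xy) := (rV_norm_le (x - y) (ltW eta0)).1.
  by move/(_ i); rewrite !mxE.
apply/negP; rewrite -ltNge.
apply: (@le_lt_trans _ _ (\sum_(i < m) d / m.+1%:R)).
  apply: ler_sum => i _.
  have -> : d / m.+1%:R = d / (2 * m.+1%:R) + d / (2 * m.+1%:R).
    by field; rewrite addrC natr1 pnatr_eq0.
  have := gx i; set e := d / _ => ge.
  have e0 : 0 < e by rewrite divr_gt0 // mulr_gt0 // ltr0n.
  by case: (ger0P (_.@[_])) => H; lra.
rewrite sumr_const card_ord -[_ *+ m]mulr_natl mulrA ltr_pdivrMr ?ltr0n //.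
by rewrite mulrC ltr_pM2l // ltr_nat.
Qed.

(** Equivalence of norms: [f] is Lipschitz for the sup norm, so it has a positive minimum on the
    unit sphere. *)
Lemma norm_dominates n (f : 'rV[R]_n -> R) :
  (forall v, 0 <= f v) -> (forall v, f v = 0 -> v = 0) ->
  (forall a v, f (a *: v) = `|a| * f v) ->
  (forall v w, f (v + w) <= f v + f w) ->
  exists2 K, 0 < K & forall (v : 'rV[R]_n) i, `|v 0 i| <= K * f v.
Proof.
move=> f0 feq0 fZ fD.
have f_sum (v : 'rV[R]_n) : f v <= `|v| * \sum_i f (delta_mx 0 i).
  have fs (r : seq 'I_n) (F : 'I_n -> 'rV[R]_n) :
      f (\sum_(i <- r) F i) <= \sum_(i <- r) f (F i).
    elim: r => [|i r IH]; first by rewrite !big_nil -(scale0r 0) fZ normr0 mul0r.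
    by rewrite !big_cons; apply: le_trans (fD _ _) _; rewrite lerD2l.
  rewrite {1}[v]row_sum_delta; apply: le_trans (fs _ _) _.
  rewrite mulr_sumr; apply: ler_sum => i _; rewrite fZ ler_wpM2r //.
  exact: ((rV_norm_le v (normr_ge0 v)).1 (lexx _)).
set C := \sum_i _ in f_sum.
have C0 : 0 <= C by apply: sumr_ge0.
have f_le v w : f v <= f w + `|v - w| * C.
  rewrite -[v in f v](subrK w) addrC; apply: le_trans (fD _ _) _.
  by rewrite lerD2l.
have fB v w : `|f v - f w| <= `|v - w| * C.
  by rewrite ler_distl lerBlDr [in f v + _]distrC !f_le.
have fc : continuous f.
  by apply: (@lipschitz_continuous _ _ C) => v w; rewrite mulrC.
pose S := [set v : 'rV[R]_n | `|v| = 1].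
have Sc : compact S.
  apply: (@subclosed_compact _ _ _ _ (@box_compact n 1)).
    apply: (@preimage_closed _ _ (fun v : 'rV[R]_n => `|v|) [set 1]);
      last exact: closed_eq.
    by move=> v _; apply: norm_continuous.
  by move=> v; rewrite /S /= => v1; apply/(rV_norm_le v ler01); rewrite v1.
have [v Sv|d d0 dP] := compact_min_gt0 Sc fc.
  rewrite lt_neqAle f0 andbT eq_sym; apply/eqP => /feq0 v0.
  by move: Sv; rewrite /S /= v0 normr0 => /esym/eqP; rewrite oner_eq0.
exists d^-1; first by rewrite invr_gt0.
move=> v i; have [->|v0] := eqVneq v 0.
  by rewrite mxE normr0 mulr_ge0 ?invr_ge0 // ltW.
apply: (@le_trans _ _ `|v|); first exact: ((rV_norm_le v (normr_ge0 v)).1 (lexx _)).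
have nv0 : 0 < `|v| by rewrite normr_gt0.
have /dP : S (`|v|^-1 *: v).
  by rewrite /S /= normrZ ger0_norm ?invr_ge0 // mulVf // gt_eqF.
rewrite fZ ger0_norm ?invr_ge0 // ler_pdivlMl // => dv.
by rewrite ler_pdivlMl // mulrC.
Qed.

End Compactness.

(** * Coefficient bounds *)

Section Coefficients.
Variables (R : realType) (n : nat).
Local Notation mp := {mpoly R[n]}.

Lemma mcoeff_bounded (p : mp) : exists2 K, 0 <= K & forall ga, `|p@_ga| <= K.
Proof.
exists (\sum_(ga <- msupp p) `|p@_ga|); first exact: sumr_ge0.
move=> ga; have [gp|/memN_msupp_eq0->] := boolP (ga \in msupp p).
  by rewrite (bigD1_seq ga) ?msupp_uniq //= lerDl sumr_ge0.
by rewrite normr0 sumr_ge0.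
Qed.

(** The given norm is pulled back to row vectors listing all coefficients of degree at most [L],
    where [norm_dominates] applies. From here on only coefficient bounds matter. *)
Lemma norm_bounds_coef L k (nu : 'M[mp]_k -> R) : is_norm_on_deg_le L nu ->
  exists2 K, 0 < K & forall A, mxdeg_le L A ->
    forall i j ga, `|(A i j)@_ga| <= K * nu A.
Proof.
move=> [nu0 nueq0 nuZ nuD].
pose T : finType := ('I_k * 'I_k * 'X_{1..n < L.+1})%type.
pose mx (v : 'rV[R]_#|T|) : 'M[mp]_k :=
  \matrix_(i, j) \sum_(ga : 'X_{1..n < L.+1}) v 0 (enum_rank ((i, j, ga) : T)) *: 'X_[ga].
have mxL v : mxdeg_le L (mx v).
  move=> i j; rewrite mxE; apply: deg_le_sum => ga.
  by rewrite -mul_mpolyC; apply: deg_leZ; rewrite /deg_le msizeX bmdeg.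
have mxc v i j (ga : 'X_{1..n < L.+1}) :
    (mx v i j)@_ga = v 0 (enum_rank ((i, j, ga) : T)).
  rewrite mxE raddf_sum (bigD1 ga) //= mcoeffZ mcoeffX eqxx mulr1 big1 ?addr0 //.
  by move=> ga' /negPf ne; rewrite mcoeffZ mcoeffX -[_ == _]/(ga' == ga) ne mulr0.
have mxeq0 v : mx v = 0 -> v = 0.
  move=> v0; apply/rowP => t; rewrite -(enum_valK t) mxE.
  by case: (enum_val t) => [[i j] ga]; rewrite -mxc v0 mxE mcoeff0.
have mxZ a v : mx (a *: v) = a%:MP *: mx v.
  apply/matrixP => i j; rewrite !mxE mulr_sumr; apply: eq_bigr => ga _.
  by rewrite mxE mul_mpolyC scalerA.
have mxD v w : mx (v + w) = mx v + mx w.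
  apply/matrixP => i j; rewrite !mxE -big_split; apply: eq_bigr => ga _.
  by rewrite mxE scalerDl.
have [|v /(nueq0 _ (mxL v))/mxeq0|a v|v w|K K0 KP] :=
  @norm_dominates R _ (nu \o mx) => //=.
- by move=> v; apply: nu0.
- by rewrite mxZ nuZ.
- by rewrite mxD nuD.
exists K => // A AL i j ga.
pose v : 'rV[R]_#|T| := \row_(t < #|T|)
  let s : 'I_k * 'I_k * 'X_{1..n < L.+1} := enum_val t in
  (A s.1.1 s.1.2)@_(s.2 : 'X_{1..n < L.+1}).
have Av : mx v = A.
  apply/matrixP => s t; rewrite mxE [RHS](mpolywE (AL s t)); apply: eq_bigr => de _.
  by rewrite mxE enum_rankK.
have [gaL|gaL] := ltnP (mdeg ga) L.+1.
  rewrite -{1}Av -[ga]/(val (BMultinom gaL)) mxc.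
  by have := KP v (enum_rank ((i, j, BMultinom gaL) : T)); rewrite /= Av.
rewrite memN_msupp_eq0 ?normr0 ?mulr_ge0 ?nu0 // ?ltW //.
by apply: msize_mdeg_ge; apply: leq_trans gaL; apply: AL.
Qed.

(** Dividing the coordinates by [c] puts them in [-1, 1], where products and powers are compared
    factor by factor. The constant is uniform over all admissible [p]. *)
Lemma meval_lipschitz D (K c : R) : 0 <= K -> 0 < c -> exists2 C, 0 <= C &
  forall p : mp, deg_le D p -> (forall ga, `|p@_ga| <= K) ->
  forall x : 'rV[R]_n, (forall l, `|x 0 l| <= c) -> `|p.@[x 0]| <= C /\
    forall (y : 'rV[R]_n) eta, 0 <= eta -> (forall l, `|y 0 l| <= c) ->
      (forall l, `|x 0 l - y 0 l| <= eta) -> `|p.@[x 0] - p.@[y 0]| <= C * eta.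
Proof.
move=> K0 c0.
pose cga (ga : 'X_{1..n < D.+1}) := \prod_(l < n) (c ^+ (ga : 'X_{1..n}) l).
have cga0 ga : 0 <= cga ga by apply: prodr_ge0 => l _; rewrite exprn_ge0 // ltW.
pose C1 := \sum_(ga : 'X_{1..n < D.+1}) K * cga ga.
pose C2 := \sum_(ga : 'X_{1..n < D.+1})
  K * (cga ga * \sum_(l < n) ((ga : 'X_{1..n}) l)%:R / c).
have C10 : 0 <= C1 by apply: sumr_ge0 => ga _; apply: mulr_ge0.
have C20 : 0 <= C2.
  apply: sumr_ge0 => ga _; do 2![apply: mulr_ge0 => //]; apply: sumr_ge0 => l _.
  by rewrite divr_ge0 // ltW.
have x1 (x : 'rV[R]_n) l : (forall l, `|x 0 l| <= c) -> `|x 0 l / c| <= 1.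
  by move=> xc; rewrite normrM normfV (gtr0_norm c0) ler_pdivrMr // mul1r.
have xX1 (x : 'rV[R]_n) : (forall l, `|x 0 l| <= c) ->
    forall (ga : 'X_{1..n < D.+1}) l, `|(x 0 l / c) ^+ (ga : 'X_{1..n}) l| <= 1.
  by move=> xc ga l; rewrite normrX exprn_ile1 // x1.
exists (C1 + C2) => [|p pD pK x xc]; first exact: addr_ge0.
have pE (z : 'rV[R]_n) : p.@[z 0] = \sum_(ga : 'X_{1..n < D.+1})
    p@_ga * (cga ga * \prod_(l < n) (z 0 l / c) ^+ (ga : 'X_{1..n}) l).
  rewrite {1}(mpolywE pD) raddf_sum /=; apply: eq_bigr => ga _.
  rewrite mevalZ mevalX -big_split /=; congr (_ * _); apply: eq_bigr => l _.
  by rewrite -exprMn mulrC divfK // gt_eqF.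
split.
  rewrite pE; apply: le_trans (ler_norm_sum _ _ _) _.
  apply: (@le_trans _ _ C1); last by rewrite lerDl.
  apply: ler_sum => ga _; rewrite normrM; apply: ler_pM => //.
  have [H _] := dist_prod_le (index_enum _) (xX1 x xc ga) (xX1 x xc ga).
  by rewrite normrM (ger0_norm (cga0 ga)) ler_piMr.
move=> y eta eta0 yc xy; rewrite !pE -sumrB; apply: le_trans (ler_norm_sum _ _ _) _.
apply: (@le_trans _ _ (C2 * eta)); last by rewrite ler_wpM2r // lerDr.
rewrite mulr_suml; apply: ler_sum => ga _.
rewrite -mulrBr normrM -mulrA; apply: ler_pM => //.
rewrite -mulrBr normrM (ger0_norm (cga0 ga)) -mulrA ler_wpM2l //.
have [_ H] := dist_prod_le (index_enum _) (xX1 x xc ga) (xX1 y yc ga).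
apply: le_trans H _; rewrite mulr_suml; apply: ler_sum => l _.
apply: le_trans (dist_exp_le _ (x1 x l xc) (x1 y l yc)) _.
rewrite -mulrBl normrM normfV (gtr0_norm c0) -mulrA ler_wpM2l //.
by rewrite mulrC ler_wpM2l // invr_ge0 ltW.
Qed.

Lemma mxeval_qform_lipschitz k D (K c : R) : 0 <= K -> 0 < c -> exists2 C, 0 <= C &
  forall A : 'M[mp]_k, mxdeg_le D A -> (forall i j ga, `|(A i j)@_ga| <= K) ->
  forall x : 'rV[R]_n, (forall l, `|x 0 l| <= c) ->
    forall v : 'cV[R]_k, - (C * \sum_i v i 0 ^+ 2) <= qform (mxeval A x) v /\
    forall (y : 'rV[R]_n) eta, 0 <= eta -> (forall l, `|y 0 l| <= c) ->
      (forall l, `|x 0 l - y 0 l| <= eta) ->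
      qform (mxeval A y) v - C * eta * \sum_i v i 0 ^+ 2 <= qform (mxeval A x) v.
Proof.
move=> K0 c0; have [C C0 CP] := meval_lipschitz D K0 c0.
exists (k%:R * C); first by rewrite mulr_ge0.
move=> A AD AK x xc v; split.
  have := @qform_bound R k (mxeval A x) C v.
  rewrite ler_norml => H; apply: (proj1 (andP (H _))) => i j.
  by rewrite mxE; have [] := CP _ (AD i j) (AK i j) x xc.
move=> y eta eta0 yc xy.
have := @qform_bound R k (mxeval A x - mxeval A y) (C * eta) v.
rewrite qformD qformN ler_norml mulrA => H.
rewrite lerBlDr -lerBlDl.
suff /H/andP[] : forall i j, `|(mxeval A x - mxeval A y) i j| <= C * eta by lra.
by move=> i j; rewrite !mxE; have [_] := CP _ (AD i j) (AK i j) x xc; apply.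
Qed.

End Coefficients.

(** * The Positivstellensatz *)

Lemma exists_nat_small (R : realType) (a e : R) : 0 < e ->
  exists N, forall d, (N <= d)%N -> a / d.+1%:R < e.
Proof.
move=> e0; exists (Num.truncn (a / e)) => d Nd.
rewrite ltr_pdivrMr ?ltr0n // mulrC -ltr_pdivrMr //.
by apply: lt_le_trans (truncnS_gt _) _; rewrite ler_nat ltnS.
Qed.

(** For t > 0, Bernoulli bounds [p.+1%:R * t] by (1 + t)^(p+1), and the product of the (p+1)-th
    powers of 1 - t and 1 + t is at most 1. *)
Lemma damped_le_inv (R : realFieldType) (t : R) p : -1 <= t <= 1 ->
  t * (1 - t) ^+ p.+1 <= p.+1%:R^-1.
Proof.
move=> /andP[t1 t2]; have [t0|t0] := leP t 0.
  apply: (@le_trans _ _ 0); last by rewrite invr_ge0 ler0n.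
  by apply: mulr_le0_ge0 => //; rewrite exprn_ge0 // subr_ge0.
have bern1 N : 1 + N%:R * t <= (1 + t) ^+ N.
  elim: N => [|N IH]; first by rewrite mul0r addr0 expr0.
  rewrite exprS; have N0 : 0 <= N%:R :> R by rewrite ler0n.
  have t10 : 0 <= 1 + t by lra.
  apply: le_trans (ler_wpM2l t10 IH); rewrite -natr1; nra.
rewrite -[leRHS]mul1r ler_pdivlMr ?ltr0n //.
have : (1 - t) ^+ p.+1 * (1 + t) ^+ p.+1 <= 1.
  by rewrite -exprMn exprn_ile1 //; nra.
have : 0 <= (1 - t) ^+ p.+1 by rewrite exprn_ge0 // subr_ge0.
have := bern1 p.+1; set x := (1 - t) ^+ _; set y := (1 + t) ^+ _; set N := p.+1%:R.
move=> ? ? ?; nra.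
Qed.

Lemma damped_le_id (R : realFieldType) (t : R) p : t <= 0 -> t * (1 - t) ^+ p <= t.
Proof.
move=> t0; rewrite -[leRHS]mulr1 ler_wnM2l // exprn_ege1 //; lra.
Qed.

Section Positivstellensatz.
Variables (R : realType) (n m : nat) (g : 'I_m -> {mpoly R[n]}).
Local Notation mp := {mpoly R[n]}.
Local Notation mpC := (@mpolyC n R).
Local Notation TQ := (truncated_quadratic_module g).

Lemma near_square_bern_box (c : R) d (al : {ffun 'I_n -> 'I_d.+1}) :
  (forall l, bnd g 2^-1 (c^-1 *: 'X_l)) -> near_square g (bern_box c al).
Proof.
move=> cX; apply: near_square_prod => l.
rewrite /bern -mul_mpolyC; apply: near_squareM; first by apply: near_squareC; rewrite ler0n.
have h0 : 0 <= 2^-1 :> R by rewrite invr_ge0.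
rewrite -!mul_mpolyC; apply: near_squareM; apply: near_squareX; apply: near_squareM;
  try exact: near_squareC.
  rewrite -[X in 1 + X]opprK mul_mpolyC; apply: near_square_1B; apply: bndN.
  exact: cX.
by apply: near_square_1B; rewrite mul_mpolyC; exact: cX.
Qed.

(** The Bernstein polynomials lie in the module only after adding [eta]. The resulting excess
    [eta *: \sum_al P al] is taken out of the additional [e] times the identity, and what remains is
    still a Gram matrix. *)
Lemma box_positivstellensatz k D (K c e : R) :
  0 < c -> (forall l, bnd g 2^-1 (c^-1 *: 'X_l)) -> 0 <= K -> 0 < e ->
  exists N, forall A : 'M[mp]_k, A^T = A -> mxdeg_le D A ->
    (forall i j ga, `|(A i j)@_ga| <= K) ->
    (forall x : 'rV[R]_n, (forall l, `|x 0 l| <= c) ->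
      forall v : 'cV[R]_k, e * \sum_i v i 0 ^+ 2 <= qform (mxeval A x) v) ->
    TQ N (A + (e%:MP)%:M).
Proof.
move=> c0 cX K0 e0; have [C [C0 CP]] := bern_box_coef_approx n c0 D K0.
(* Makes the quadratic form of each [P al] differ by less than [e] from that of a value of [A]. *)
have [d0 d0P] := exists_nat_small (k%:R * C) e0.
pose d := maxn D d0; have dC := d0P d (leq_maxr _ _).
have Dd : (D <= d)%N := leq_maxl _ _.
pose T : finType := {ffun 'I_n -> 'I_d.+1}.
(* Chosen so that [eta] times the sum of all [P al] stays below [e] as a quadratic form. *)
have [p0 /(_ p0 (leqnn _)) pP] := exists_nat_small (k%:R * (#|T|%:R * C)) e0.
pose eta : R := p0.+1%:R^-1; have eta0 : 0 < eta by rewrite invr_gt0 ltr0n.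
have /fin_all_exists[N NP] (al : T) :
    exists N, TQ N ((bern_box c al + eta%:MP)%:M : 'M_1).
  apply: qm_truncated; apply: near_square_qms => //.
  exact: near_square_bern_box.
have [N1 N1P] : exists N1, TQ N1 ((1%:MP)%:M : 'M_1).
  by apply: qm_truncated; apply: qmsC; rewrite ler01.
exists (maxn N1 (\max_al N al)) => A As AD AK Apos.
pose P (al : T) : 'M[R]_k := \matrix_(i, j) bern_box_coef c D (A i j) al.
have AE : A = \sum_al bern_box c al *: map_mx mpC (P al).
  apply/matrixP => i j; rewrite summxE [LHS](bern_boxE c0 (AD i j) Dd).
  by apply: eq_bigr => al _; rewrite !mxE mulrC mul_mpolyC.
have Ppos al : posdef (P al).
  split; first by apply/matrixP => i j; rewrite !mxE -[in LHS]As mxE.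
  move=> v v0; set y := bern_box_node c al.
  have yc l : `|y 0 l| <= c.
    by rewrite mxE normrM (gtr0_norm c0) ler_piMr ?bern_node_le1 ?leq_ord // ltW.
  have := @qform_bound R k (P al - mxeval A y) (C / d.+1%:R) v.
  rewrite qformD qformN ler_norml => H.
  have /H/andP[+ _] : forall i j, `|(P al - mxeval A y) i j| <= C / d.+1%:R.
    by move=> i j; rewrite !mxE; have [] := CP d _ Dd (AD i j) (AK i j) al.
  have := Apos y yc v; have := sqr_norm_gt0 v0; rewrite mulrA.
  set s := \sum_i _; move: dC; set q := _ / _; move=> *; nra.
pose Q : 'M[R]_k := e%:M - eta *: \sum_al P al.
have Qpos : posdef Q.
  split.
    rewrite raddfB /= tr_scalar_mx linearZ /= raddf_sum; congr (_ - _ *: _).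
    by apply: eq_bigr => al _; case: (Ppos al).
  move=> v v0; rewrite qformD qformN qform_scalar.
  have := @qform_bound R k (eta *: \sum_al P al) (eta * (#|T|%:R * C)) v.
  rewrite ler_norml => H.
  have /H/andP[_] : forall i j,
      `|(eta *: \sum_al P al) i j| <= eta * (#|T|%:R * C).
    move=> i j; rewrite mxE summxE normrM (gtr0_norm eta0) ler_pM2l //.
    apply: le_trans (ler_norm_sum _ _ _) _; rewrite mulr_natl -sumr_const.
    by apply: ler_sum => al _; rewrite mxE; have [] := CP d _ Dd (AD i j) (AK i j) al.
  have re : k%:R * (eta * (#|T|%:R * C)) < e by rewrite mulrCA mulrC.
  have := sqr_norm_gt0 v0; move: re; set r := _ * (_ * _); move=> *; nra.
have -> : A + (e%:MP)%:M = 1%:MP *: map_mx mpC Q +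
    \sum_al (bern_box c al + eta%:MP) *: map_mx mpC (P al).
  under eq_bigr do rewrite scalerDl.
  rewrite big_split /= -AE scale1r /Q raddfB /= map_scalar_mx.
  rewrite -scaler_sumr [map_mx mpC (eta *: _)]map_mxZ raddf_sum /=.
  by rewrite [RHS]addrACA addNr addr0 addrC.
apply: tqm_add.
  have [B ->] := posdef_gram Qpos; apply: tqmW (leq_maxl _ _) _.
  exact: tqm_const_gram.
apply: tqm_sum => al; have [B ->] := posdef_gram (Ppos al).
apply: tqmW (leq_trans (leq_bigmax al) (leq_maxr _ _)) _.
exact: tqm_const_gram.
Qed.

Lemma common_radius : archimedean g ->
  exists2 c : R, 0 < c & forall l, bnd g 2^-1 (c^-1 *: 'X_l).
Proof.
move=> arch; have /fin_all_exists[r rP] := fun l => bnd_exists arch 'X_l.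
have r0 l : 0 < r l by have [] := rP l.
have c0 : 0 < 1 + 2 * \sum_l r l.
  by rewrite ltr_pwDl // mulr_ge0 // sumr_ge0 // => l _; rewrite ltW.
exists (1 + 2 * \sum_l r l) => // l.
apply: bndW (bndZ _ (rP l)); last by rewrite invr_gt0.
rewrite ler_pdivrMl // mulrDl mul1r mulrAC divff ?pnatr_eq0 // mul1r.
rewrite (bigD1 l) //= addrCA lerDl addr_ge0 ?invr_ge0 // sumr_ge0 // => i _.
exact: ltW.
Qed.

(** Near the semialgebraic set, [A] loses at most tau / 2 by Lipschitz continuity and [q] is at most
    tau / 4. Elsewhere some [g i] is at most [- d], and [q] falls below the lower bound [- C] of
    [A]. The same [q] serves every [A]. *)
Lemma penalty k L (K c tau : R) : 0 <= K -> 0 < c -> 0 < tau ->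
  exists2 q, qms g q & forall A : 'M[mp]_k, mxdeg_le L A ->
    (forall i j ga, `|(A i j)@_ga| <= K) ->
    (forall x, semialg_set g x -> loewner_ge (mxeval A x) tau%:M) ->
    forall x : 'rV[R]_n, (forall l, `|x 0 l| <= c) -> forall v : 'cV[R]_k,
      (q.@[x 0] + tau / 4) * \sum_i v i 0 ^+ 2 <= qform (mxeval A x) v.
Proof.
move=> K0 c0 tau0.
(* The nearby point of the semialgebraic set may leave the box, but as [eta <= 1] it stays in the
   box of radius [c + 1]. *)
have c1 : 0 < c + 1 by rewrite addr_gt0.
have [C C0 CP] := @mxeval_qform_lipschitz R n k L K _ K0 c1.
pose eta := Num.min 1 (tau / (2 * (C + 1))).
have C1 : 0 < C + 1 by rewrite ltr_wpDl.
have eta0 : 0 < eta by rewrite lt_min ltr01 divr_gt0 // mulr_gt0.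
have eta1 : eta <= 1 by rewrite ge_min lexx.
have Ceta : C * eta <= tau / 2.
  have : eta <= tau / (2 * (C + 1)) by rewrite ge_min lexx orbT.
  rewrite ler_pdivlMr ?mulr_gt0 // => H; nra.
have [d d0 dP] := far_from_semialg g c eta0.
have [G G0 GP] : exists2 G, 0 < G & forall i (x : 'rV[R]_n),
    (forall l, `|x 0 l| <= c) -> `|(g i).@[x 0]| <= G.
  have /fin_all_exists[H HP] i : exists H, 0 <= H /\ forall x : 'rV[R]_n,
      (forall l, `|x 0 l| <= c) -> `|(g i).@[x 0]| <= H.
    have [Kg Kg0 KgP] := mcoeff_bounded (g i).
    have [H H0 HP] := @meval_lipschitz R n (msize (g i)) Kg c Kg0 c0.
    by exists H; split=> // x xc; have [] := HP (g i) (leqnSn _) KgP x xc.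
  have H0 i : 0 <= H i by case: (HP i).
  exists (1 + \sum_i H i); first by rewrite ltr_pwDl // sumr_ge0.
  move=> i x xc; apply: le_trans ((HP i).2 x xc) _.
  by rewrite (bigD1 i) //= addrCA lerDl addr_ge0 // sumr_ge0.
pose w := (C + tau) / d.
have w0 : 0 < w by rewrite divr_gt0 // ltr_wpDl.
have wd : w * d = C + tau by rewrite divfK // gt_eqF.
have t4 : 0 < tau / 4 by rewrite divr_gt0.
have [p /(_ p (leqnn _)) pP] := exists_nat_small (w * (m%:R * G)) t4.
(* Squaring keeps [s i] in the module. Dividing by [G] brings [g i] into [-1, 1] on the box, as
   [damped_le_inv] requires. *)
pose s i : mp := (1 - G^-1 *: g i) ^+ p.+1 ^+ 2 * g i.
exists (w *: \sum_i s i).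
  by apply: qmsZ; [exact: ltW | apply: qms_sum => i; apply/qms_sqrM/qms_gen].
move=> A AL AK Apos x xc v; rewrite mevalZ raddf_sum /=.
pose t i := (g i).@[x 0] / G.
have tE i : (g i).@[x 0] = G * t i by rewrite mulrC divfK // gt_eqF.
have t1 i : -1 <= t i <= 1.
  by rewrite -ler_norml normrM normfV (gtr0_norm G0) ler_pdivrMr // mul1r GP.
have sE i : (s i).@[x 0] = G * (t i * (1 - t i) ^+ (p.+1 * 2)).
  by rewrite mevalM !rmorphXn /= mevalB meval1 mevalZ -exprM tE mulKf ?gt_eqF //; ring.
have s_le i : (s i).@[x 0] <= G / p.+1%:R.
  rewrite sE ler_pM2l // muln2 doubleS; apply: le_trans (damped_le_inv _ (t1 i)) _.
  by rewrite lef_pV2 ?posrE ?ltr0n // ler_nat ltnS leqW // -addnn leq_addr.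
have sneg i : (g i).@[x 0] <= - d -> (s i).@[x 0] <= - d.
  move=> gd; apply: (le_trans _ gd); rewrite sE tE ler_pM2l //; apply: damped_le_id.
  by rewrite -(pmulr_rle0 _ G0) -tE (le_trans gd) // oppr_le0 ltW.
have ms : w * (m%:R * (G / p.+1%:R)) < tau / 4 by rewrite [m%:R * _]mulrA mulrA.
have v0 : 0 <= \sum_i v i 0 ^+ 2 by apply: sumr_ge0 => i _; apply: sqr_ge0.
have xc1 l : `|x 0 l| <= c + 1 by rewrite (le_trans (xc l)) // lerDl.
have [Alow Alip] := CP A AL AK x xc1 v.
have [[i gi]|gnear] := pselect (exists i, (g i).@[x 0] <= - d).
  have q_le : w * \sum_i (s i).@[x 0] <= - (C + tau) + tau / 4.
    apply: (@le_trans _ _ (w * (- d + m%:R * (G / p.+1%:R)))); last first.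
      by rewrite mulrDr mulrN wd lerD2l ltW.
    rewrite ler_pM2l // (bigD1 i) //=; apply: lerD; first exact: sneg.
    apply: (@le_trans _ _ (\sum_(j | j != i) G / p.+1%:R)); first exact: ler_sum.
    rewrite mulr_natl -[in leRHS](card_ord m) -sumr_const [leRHS](bigD1 i) //=.
    by rewrite lerDr divr_ge0 ?ler0n // ltW.
  move: q_le Alow v0; set q := w * _; set S := \sum_i v i 0 ^+ 2; move=> *; nra.
have [|y yS xy] := dP x xc.
  by move=> i; rewrite ltNge; apply/negP => gi; apply: gnear; exists i.
have yc1 l : `|y 0 l| <= c + 1.
  have -> : y 0 l = x 0 l - (x 0 l - y 0 l) by ring.
  by apply: le_trans (ler_normB _ _) _; apply: lerD; rewrite // (le_trans (xy l)).
have q_le : w * \sum_i (s i).@[x 0] <= tau / 4.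
  apply: le_trans (ltW ms); rewrite ler_pM2l // mulr_natl -[in leRHS](card_ord m).
  by rewrite -sumr_const; apply: ler_sum.
have := Alip y eta (ltW eta0) yc1 xy.
have [_ /(_ v)] := Apos y yS; rewrite -/(qform _ _) qformD qformN qform_scalar.
move: Ceta q_le v0; set q := w * _; set S := \sum_i v i 0 ^+ 2; set z := C * eta.
by move=> *; nra.
Qed.

End Positivstellensatz.

Theorem theorem3p2 (R : realType) (n m k : nat)
    (n_gt0 : (0 < n)%N) (m_gt0 : (0 < m)%N) (k_gt0 : (0 < k)%N)
    (nrm : nat -> 'M[{mpoly R[n]}]_k -> R)
    (nrmP : forall L : nat, (0 < L)%N -> is_norm_on_deg_le L (nrm L))
    (g : 'I_m -> {mpoly R[n]})
    (g_arch : archimedean g) :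
  forall L : nat, (0 < L)%N ->
  exists N : nat, (0 < N)%N /\
    forall A : 'M[{mpoly R[n]}]_k,
      A^T = A ->
      mxdeg_le L A ->
      nrm L A <= L%:R ->
      (forall x : 'rV[R]_n, semialg_set g x ->
         loewner_ge (mxeval A x) ((L%:R^-1)%:M)) ->
      truncated_quadratic_module g N A.
Proof.
move=> L L0; have [K0 K00 K0P] := norm_bounds_coef (nrmP L L0).
pose K := K0 * L%:R; have Kpos : 0 <= K by rewrite mulr_ge0 ?ler0n // ltW.
pose tau : R := L%:R^-1; have tau0 : 0 < tau by rewrite invr_gt0 ltr0n.
have [c c0 cX] := common_radius g_arch.
have [q qM qP] := @penalty R n m g k L K c tau Kpos c0 tau0.
(* The penalty leaves a margin tau / 4 = 2e: one [e] is subtracted along with [q], the other is the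
   positivity required on the box. *)
pose e := tau / 8; have e0 : 0 < e by rewrite divr_gt0.
have [Kq Kq0 KqP] := mcoeff_bounded (q + e%:MP).
pose D := maxn L (msize (q + e%:MP)).
have [N1 N1P] := @box_positivstellensatz R n m g k D (K + Kq) c e c0 cX
  (addr_ge0 Kpos Kq0) e0.
have [N2 N2P] := qm_truncated qM.
exists (maxn N1 N2).+1; split=> // A As AL AnL Apos.
have AK i j ga : `|(A i j)@_ga| <= K.
  by apply: le_trans (K0P A AL i j ga) _; rewrite ler_pM2l.
(* The first two summands are covered by the box certificate, the last by the membership of [q] in
   the module. *)
have -> : A = (A - (q + e%:MP)%:M) + (e%:MP)%:M +
    q *: map_mx (@mpolyC n R) (1%:M^T *m 1%:M).
  rewrite trmx1 mul1mx map_scalar_mx rmorph1 scale_scalar_mx mulr1 raddfD /=.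
  by rewrite opprD addrA !subrK.
apply: tqm_add; last first.
  by apply: tqm_const_gram; apply: tqmW N2P; rewrite leqW // leq_maxr.
apply: (@tqmW _ _ _ _ _ N1); first by rewrite leqW // leq_maxl.
apply: N1P.
- by rewrite raddfB /= tr_scalar_mx As.
- move=> i j; rewrite !mxE; apply: deg_le_add.
    exact: deg_leW (leq_maxl _ _) (AL i j).
  rewrite /deg_le msizeN; case: (i == j); last by rewrite msize0.
  by rewrite mulr1n leqW // leq_maxr.
- move=> i j ga; rewrite !mxE mcoeffB; apply: le_trans (ler_normB _ _) _.
  apply: lerD => //; case: (i == j); first by rewrite mulr1n.
  by rewrite mulr0n mcoeff0 normr0.
- move=> x xc v; have := qP A AL AK Apos x xc v.
  have -> : mxeval (A - (q + e%:MP)%:M) x = mxeval A x - (q.@[x 0] + e)%:M.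
    by apply/matrixP => i j; rewrite !mxE mevalB mevalMn mevalD mevalC.
  rewrite qformD qformN qform_scalar.
  have -> : tau / 4 = e + e by rewrite /e; field.
  lra.
Qed.
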